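(* Let $1\le k\le n$, let $A\in\mathbb{R}^{n\times n}$ be symmetric and nonsingular, and let $J\in\mathbb{R}^{k\times k}$ be symmetric with $J^2=I_k$. Let $X\mapsto \mathbf{M}_X$ be a map assigning to each $X\in\mathrm{iSt}_{A,J}(k,n)$ a symmetric positive-definite matrix $\mathbf{M}_X\in\mathbb{R}^{n\times n}$ depending smoothly on $X$. Let $f:\mathrm{iSt}_{A,J}(k,n)\to\mathbb{R}$ be continuously differentiable, let $X\in\mathrm{iSt}_{A,J}(k,n)$, and let $\bar f$ be any smooth (i.e. continuously differentiable) extension of $f$ to a neighborhood of $X$ in $\mathbb{R}^{n\times k}$. Then the Riemannian gradient of $f$ at $X$ with respect to $\mathrm{g}_{\mathbf{M}_X}$ is $$\mathrm{grad}_{\mathbf{M}_X}f(X)=\mathbf{M}_X^{-1}\nabla\bar f(X)-\mathbf{M}_X^{-1}AXU_{\bar f},$$ where $U_{\bar f}$ is the unique solution to the Lyapunov equation with unknown $U\in\mathbb{R}^{k\times k}$ $$(X^TA\mathbf{M}_X^{-1}AX)U+U(X^TA\mathbf{M}_X^{-1}AX)=2\,\mathrm{sym}\bigl(X^TA\mathbf{M}_X^{-1}\nabla\bar f(X)\bigr).$$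
   Context: $\mathrm{iSt}_{A,J}(k,n)=\{X\in\mathbb{R}^{n\times k} : X^TAX=J\}$ is the indefinite Stiefel manifold, an embedded submanifold of $\mathbb{R}^{n\times k}$ whenever nonempty, with tangent space $T_X\mathrm{iSt}_{A,J}(k,n)=\{Z\in\mathbb{R}^{n\times k}: Z^TAX+X^TAZ=0\}$. The metric is $\mathrm{g}_{\mathbf{M}_X}(Z_1,Z_2)=\mathrm{tr}(Z_1^T\mathbf{M}_XZ_2)$. The Riemannian gradient $\mathrm{grad}_{\mathbf{M}_X}f(X)$ is the unique vector of $T_X\mathrm{iSt}_{A,J}(k,n)$ satisfying $$\mathrm{g}_{\mathbf{M}_X}(\mathrm{grad}_{\mathbf{M}_X}f(X),Z)=\mathrm{D}\bar f(X)[Z]=\mathrm{tr}(\nabla\bar f(X)^TZ)\quad\text{for all } Z\in T_X\mathrm{iSt}_{A,J}(k,n),$$ where $\nabla\bar f(X)\in\mathbb{R}^{n\times k}$ is the Euclidean gradient of $\bar f$ at $X$. For a square matrix $\Omega$, $\mathrm{sym}(\Omega)=\frac12(\Omega+\Omega^T)$. *)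

(* Defs.v *)
From HB Require Import structures.
From mathcomp Require Import all_boot all_order all_algebra.
From mathcomp Require Import all_classical all_reals all_analysis.

Set Implicit Arguments.
Unset Strict Implicit.
Unset Printing Implicit Defensive.

Import Order.TTheory GRing.Theory Num.Theory.
Import numFieldNormedType.Exports.

Local Open Scope classical_set_scope.
Local Open Scope ring_scope.

Section Regularity.
Context {R : realType} {V W : normedModType R}.

(* Meant for U open; for V of finite dimension, this is the usual class C^1. *)
Definition C1_on (U : set V) (g : V -> W) : Prop :=
  (forall x, U x -> differentiable g x) /\
  (forall v x, U x -> {for x, continuous ('D_v g)}).

(* Functions on a subset S of V are total functions on V of which only the
   values on S are relevant. *)
Definition C1_extension (S : set V) (f : V -> W) (x : V) (g : V -> W) : Prop :=
  exists U : set V, [/\ open U, U x, C1_on U g & {in U `&` S, g =1 f}].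

(* For S an embedded submanifold, this is C^1 regularity in the charts of S. *)
Definition C1_along (S : set V) (f : V -> W) : Prop :=
  forall x, S x -> exists g : V -> W, C1_extension S f x g.

End Regularity.

Section IndefiniteStiefel.
Context {R : realType} {n k : nat}.

Definition sym {m : nat} (O : 'M[R]_m) : 'M[R]_m := 2^-1 *: (O + O^T).

Definition sympos {m : nat} (S : 'M[R]_m) : Prop :=
  S^T = S /\ forall v : 'cV[R]_m, v != 0 -> 0 < (v^T *m S *m v) 0 0.

Definition iSt (A : 'M[R]_n) (J : 'M[R]_k) : set 'M[R]_(n, k) :=
  [set X | X^T *m A *m X = J].

Definition tangent (A : 'M[R]_n) (X : 'M[R]_(n, k)) : set 'M[R]_(n, k) :=
  [set Z | Z^T *m A *m X + X^T *m A *m Z = 0].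

Definition metric (M : 'M[R]_n) (Z1 Z2 : 'M[R]_(n, k)) : R :=
  \tr (Z1^T *m M *m Z2).

Definition egrad (g : 'M[R]_(n, k) -> R) (X : 'M[R]_(n, k)) : 'M[R]_(n, k) :=
  \matrix_(i, j) 'D_(delta_mx i j) g X.

(* The defining property of the Riemannian gradient of f at X.  It depends on f
   only through its values on the manifold: the differential of f at X along Z
   is the one of any C^1 extension of f to a neighborhood of X. *)
Definition is_riem_grad (A : 'M[R]_n) (J : 'M[R]_k)
    (M : 'M[R]_(n, k) -> 'M[R]_n) (f : 'M[R]_(n, k) -> R)
    (X G : 'M[R]_(n, k)) : Prop :=
  tangent A X G /\
  forall g : 'M[R]_(n, k) -> R, C1_extension (iSt A J) f X g ->
  forall Z : 'M[R]_(n, k), tangent A X Z -> metric (M X) G Z = 'd g X Z.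

Definition lyapunov_sol (B C U : 'M[R]_k) : Prop := B *m U + U *m B = C.

End IndefiniteStiefel.

(* Main.v *)
(* Every tangent vector Z at X is S A X with S skew, so that S A is A-skew and the
   Cayley curve t |-> (1 - tB)^-1 (1 + tB) X, with B = S A / 2, stays in the
   manifold and leaves X with velocity Z.  Hence all C^1 extensions of f have the
   same differential along Z, and it suffices to treat fbar.  The coefficient
   matrix X^T A M^-1 A X is positive definite, which makes the Lyapunov operator
   injective, hence bijective, and its solution U symmetric; then A X U is
   trace-orthogonal to the tangent vectors because X^T A Z is skew. *)

Require Import Defs.
From HB Require Import structures.
From mathcomp Require Import all_boot all_order all_algebra.
From mathcomp Require Import all_classical all_reals all_analysis.
From mathcomp Require Import ring lra.

Import Order.TTheory GRing.Theory Num.Theory.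
Import numFieldNormedType.Exports.

Local Open Scope classical_set_scope.
Local Open Scope ring_scope.

(** * Differentials of extensions along curves in the subset *)

Lemma C1_extension_differentiable {R : realType} {V W : normedModType R}
    {S : set V} {f g : V -> W} {x : V} :
  C1_extension S f x g -> differentiable g x.
Proof. by move=> [U [_ Ux [dg _] _]]; exact: dg. Qed.

(** Near 0 both [g \o c] and [h \o c] coincide with [f \o c], so they have the same derivative,
    which the chain rule expresses through either differential. *)
Lemma C1_extension_diff_curve {R : realType} {V W : normedModType R}
    {S : set V} {f g h : V -> W} {c : R -> V} :
  C1_extension S f (c 0) g -> C1_extension S f (c 0) h ->
  derivable c 0 1 -> (\forall t \near 0, S (c t)) ->
  'd g (c 0) ('D_1 c 0) = 'd h (c 0) ('D_1 c 0).
Proof.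
move=> eg eh cD cS.
have dc : differentiable c 0 by apply/derivable1_diffP.
have chain (e : V -> W) : C1_extension S f (c 0) e ->
    'd e (c 0) ('D_1 c 0) = 'D_1 (e \o c) 0.
  move=> /C1_extension_differentiable de.
  have dec := differentiable_comp dc de.
  by rewrite (deriveE _ dec) (deriveE _ dc) (diff_comp dc de).
rewrite (chain _ eg) (chain _ eh); apply: near_eq_derive.
have cc := differentiable_continuous dc.
have [Ug [oUg Ugc _ gf]] := eg; have [Uh [oUh Uhc _ hf]] := eh.
have nUg : \forall t \near 0, Ug (c t) by apply: cc; exact: open_nbhs_nbhs.
have nUh : \forall t \near 0, Uh (c t) by apply: cc; exact: open_nbhs_nbhs.
near=> t => /=.
have Sct : S (c t) by near: t.
rewrite gf ?hf//; apply/mem_set; split => //.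
- by near: t.
- by near: t.
Unshelve. all: by end_near. Qed.

(** * Curves in the manifold with prescribed velocity *)

Lemma skew_factor {F : comNzRingType} {n k : nat} (Y Z P : 'M[F]_(n, k)) :
  P^T *m Y = 1%:M -> Z^T *m Y + Y^T *m Z = 0 ->
  exists2 S : 'M[F]_n, S^T = - S & S *m Y = Z.
Proof.
move=> PY1 ZY.
(* [Z *m P^T] already sends [Y] to [Z]; subtracting its transpose makes it skew, and the last term,
   skew because [Z^T *m Y] is, cancels the resulting error on [Y]. *)
exists (Z *m P^T - P *m Z^T + P *m (Z^T *m Y) *m P^T).
  have YZ : Y^T *m Z = - (Z^T *m Y) by apply/eqP; rewrite -addr_eq0 addrC ZY.
  rewrite [LHS]raddfD /= [X in X + _]raddfB /= !trmx_mul !trmxK YZ.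
  by rewrite opprD opprB mulNmx mulmxN mulmxA.
by rewrite mulmxDl mulmxBl -!mulmxA PY1 !mulmx1 subrK.
Qed.

(* The hypothesis on Y reads Y = (1 - B)^-1 (1 + B) X when 1 - B is invertible. *)
Lemma cayley_isometry {F : fieldType} {n k : nat} (A B : 'M[F]_n)
    (X Y : 'M[F]_(n, k)) :
  (2 : F) != 0 -> B^T *m A + A *m B = 0 -> Y - X = B *m (X + Y) ->
  Y^T *m A *m Y = X^T *m A *m X.
Proof.
move=> two0 BA YX.
(* The cross terms cancel, so this sum is twice Y^T A Y - X^T A X; substituting for Y - X turns it
   into (X + Y)^T (B^T A + A B) (X + Y). *)
have E : (Y - X)^T *m A *m (X + Y) + (X + Y)^T *m A *m (Y - X) = 0.
  rewrite YX trmx_mul -!mulmxA -mulmxDr (mulmxA B^T) (mulmxA A).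
  by rewrite -mulmxDl BA mul0mx mulmx0.
apply/eqP; rewrite -subr_eq0; apply/eqP.
apply: (scalerI two0); rewrite scaler0 -E [(_ - _)^T]raddfB /= [(_ + _)^T]raddfD /=.
rewrite !(mulmxDl, mulmxDr, mulNmx, mulmxN) scaler_nat mulr2n.
by apply/matrixP => i j; rewrite !mxE; ring.
Qed.

(* V t is (1 - tB)^-1 Z, written through the adjugate so that its entries are
   rational functions of t. *)
Lemma derivable_resolvent {R : realType} {n k : nat} (B : 'M[R]_n)
    (Z : 'M[R]_(n, k)) :
  exists V : R -> 'M[R]_(n, k),
    [/\ V 0 = Z, derivable V 0 1 &
        \forall t \near 0, V t - t *: (B *m V t) = Z].
Proof.
pose N : 'M[{poly R}]_n := 1%:M - 'X *: map_mx polyC B.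
pose W := \adj N *m map_mx polyC Z.
(* The inverse of a vanishing determinant is 0 by convention; only t near 0 matters, where the
   determinant is close to 1. *)
pose V (t : R) : 'M[R]_(n, k) := ((\det N).[t])^-1 *: map_mx (horner_eval t) W.
have NE t : map_mx (horner_eval t) N = 1%:M - t *: B.
  by apply/matrixP => i j; rewrite !mxE /horner_eval !hornerE hornerMn hornerE.
have WE t : (1%:M - t *: B) *m map_mx (horner_eval t) W = (\det N).[t] *: Z.
  rewrite -NE -map_mxM /W mulmxA mul_mx_adj mul_scalar_mx.
  by apply/matrixP => i j; rewrite !mxE /= /horner_eval !hornerE.
have N0 : (\det N).[0] = 1.
  by rewrite -[LHS]/(horner_eval 0 _) -det_map_mx NE scale0r subr0 det1.
exists V; split.
- by have := WE 0; rewrite /V N0 scale0r subr0 mul1mx invr1 !scale1r.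
- apply/derivable_mxP => i j.
  have -> : (fun x => V x i j) = (fun x => (\det N).[x]^-1 * (W i j).[x]).
    by apply/funext => x; rewrite /V !mxE.
  apply: derivableM; last exact: derivable_horner.
  apply: derivableV; last exact: derivable_horner.
  by rewrite N0 oner_neq0.
- have nz : \forall t \near 0, (\det N).[t] != 0.
    have cN : {for 0, continuous (horner (\det N))} by exact: continuous_horner.
    by apply: (cvgr_neq0 _ cN); rewrite N0 oner_neq0.
  near=> t.
  have dt0 : (\det N).[t] != 0 by near: t.
  have := congr1 (fun D => (\det N).[t]^-1 *: D) (WE t).
  by rewrite scalerA mulVf// scale1r scalemxAr mulmxBl mul1mx -scalemxAl.
Unshelve. all: by end_near. Qed.

(** The difference quotient at 0 with step h is exactly [V h], so continuity of [V] at 0 gives the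
    limit. *)
Lemma derive_affine_curve {R : realType} {W : normedModType R} (x : W)
    (V : R -> W) :
  derivable V 0 1 ->
  is_derive (0 : R) 1 (fun t => x + t *: V t) (V 0).
Proof.
move=> dV.
have cV : {for 0, continuous V}.
  by apply: differentiable_continuous; apply/derivable1_diffP.
set c := fun t : R => x + t *: V t.
have cvgq : h^-1 *: (c (h *: (1 : R) + 0) - c 0) @[h --> (0 : R)^'] --> V 0.
  have cV' : V h @[h --> (0 : R)^'] --> V 0 by exact: cvg_within_filter.
  apply: cvg_trans cV'; apply: near_eq_cvg; near=> h.
  have h0 : h != 0 by near: h; exact: nbhs_dnbhs_neq.
  rewrite /c scale0r !addr0 [h *: 1]mulr1 addrAC subrr add0r.
  by rewrite scalerA mulVf// scale1r.
split; first by apply/cvg_ex; exists (V 0).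
exact/cvg_lim.
Unshelve. all: by end_near. Qed.

Lemma tangent_curve {R : realType} {n k : nat} (A : 'M[R]_n) (J : 'M[R]_k)
    (X Z : 'M[R]_(n, k)) :
  A^T = A -> J^T = J -> J *m J = 1%:M -> iSt A J X -> tangent A X Z ->
  exists c : R -> 'M[R]_(n, k),
    [/\ c 0 = X, is_derive (0 : R) 1 c Z & \forall t \near 0, iSt A J (c t)].
Proof.
move=> A_sym J_sym J_invol XJ ZX.
have two0 : (2 : R) != 0 by rewrite pnatr_eq0.
(* J X^T is a left inverse of A X, because J X^T A X = J^2. *)
have PY : (X *m J)^T *m (A *m X) = 1%:M.
  by rewrite trmx_mul J_sym mulmxA -[J *m _ *m _]mulmxA -mulmxA XJ.
have ZY : Z^T *m (A *m X) + (A *m X)^T *m Z = 0.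
  by rewrite trmx_mul A_sym mulmxA.
have [S S_skew SX] := skew_factor _ _ _ PY ZY.
pose B := 2^-1 *: (S *m A).
have BA : B^T *m A + A *m B = 0.
  rewrite /B linearZ/= trmx_mul A_sym S_skew -scalemxAl -scalemxAr -scalerDr.
  by rewrite mulmxN mulNmx mulmxA addNr scaler0.
have BX : B *m X = 2^-1 *: Z by rewrite /B -scalemxAl -mulmxA SX.
have [V [V0 dV VE]] := derivable_resolvent B Z.
(* Since B X = Z / 2, this is the Cayley curve: (1 - tB)^-1 (1 + tB) X = X + 2t (1 - tB)^-1 B X. *)
exists (fun t => X + t *: V t); split.
- by rewrite scale0r addr0.
- by rewrite -V0; exact: derive_affine_curve.
- near=> t; rewrite /iSt /= -XJ.
  have Vt : V t - t *: (B *m V t) = Z by near: t.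
  apply: (@cayley_isometry _ _ _ _ (t *: B)) => //.
    by rewrite linearZ/= -scalemxAl -scalemxAr -scalerDr BA scaler0.
  (* The goal is t V = t B (2 X + t V); the right side equals t (Z + t B V), which is t V by
     [Vt]. *)
  rewrite addrC addKr -scalemxAl !mulmxDr BX addrA -scalerDl -scalemxAr.
  rewrite [X in X *: Z](_ : _ = 1) ?scale1r; last by lra.
  by rewrite -Vt subrK.
Unshelve. all: by end_near. Qed.

(** * Symmetric positive-definite matrices *)

Lemma sympos_unitmx {R : realType} {m : nat} (S : 'M[R]_m) :
  sympos S -> S \in unitmx.
Proof.
move=> [S_sym S_pos]; rewrite -row_free_unit -kermx_eq0.
apply/rowV0P => u /sub_kermxP uS; apply: contraPeq uS => u0 uS.
have ut0 : u^T != 0 by rewrite -trmx0 (inj_eq trmx_inj).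
by have := S_pos _ ut0; rewrite trmxK uS mul0mx mxE ltxx.
Qed.

Lemma sympos_inv {R : realType} {m : nat} (S : 'M[R]_m) :
  sympos S -> sympos (invmx S).
Proof.
move=> S_sp; have Su := sympos_unitmx _ S_sp; case: S_sp => S_sym S_pos.
have Si_sym : (invmx S)^T = invmx S by rewrite trmx_inv S_sym.
split=> // v v0.
have w0 : invmx S *m v != 0.
  by apply: contraNneq v0 => Sv; rewrite -[v](mulKVmx Su) Sv mulmx0.
by have := S_pos _ w0; rewrite trmx_mul Si_sym !mulmxA mulmxKV.
Qed.

(** The left inverse [L] makes [Y] injective, so definiteness survives the congruence. *)
Lemma sympos_congr {R : realType} {m p : nat} (S : 'M[R]_m)
    (Y : 'M[R]_(m, p)) (L : 'M[R]_(p, m)) :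
  sympos S -> L *m Y = 1%:M -> sympos (Y^T *m S *m Y).
Proof.
move=> [S_sym S_pos] LY; split; first by rewrite !trmx_mul trmxK S_sym mulmxA.
move=> v v0; have w0 : Y *m v != 0.
  by apply: contraNneq v0 => Yv; rewrite -[v]mul1mx -LY -mulmxA Yv mulmx0.
by have := S_pos _ w0; rewrite trmx_mul !mulmxA.
Qed.

(** Reduces definiteness of the trace form, hence of the metric, to that of [S] on column
    vectors. *)
Lemma mxtrace_quad {R : realType} {m p : nat} (S : 'M[R]_m)
    (Z : 'M[R]_(m, p)) :
  \tr (Z^T *m S *m Z) = \sum_j ((col j Z)^T *m S *m col j Z) 0 0.
Proof.
apply: eq_bigr => j _; rewrite !mxE; apply: eq_bigr => i _; rewrite !mxE.
by congr (_ * _); apply: eq_bigr => l _; rewrite !mxE.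
Qed.

Lemma sympos_trace_ge0 {R : realType} {m p : nat} (S : 'M[R]_m)
    (Z : 'M[R]_(m, p)) : sympos S -> 0 <= \tr (Z^T *m S *m Z).
Proof.
move=> [_ S_pos]; rewrite mxtrace_quad sumr_ge0// => j _.
have [->|/S_pos/ltW//] := eqVneq (col j Z) 0.
by rewrite mulmx0 mxE.
Qed.

Lemma sympos_trace_eq0 {R : realType} {m p : nat} (S : 'M[R]_m)
    (Z : 'M[R]_(m, p)) : sympos S -> \tr (Z^T *m S *m Z) = 0 -> Z = 0.
Proof.
move=> [_ S_pos]; rewrite mxtrace_quad => /eqP; rewrite psumr_eq0; last first.
  move=> j _; have [->|/S_pos/ltW//] := eqVneq (col j Z) 0.
  by rewrite mulmx0 mxE.
move=> /allP Z0; apply/matrixP => i j; rewrite mxE.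
have /eqP q0 := Z0 j (mem_index_enum j).
have [c0|/S_pos] := eqVneq (col j Z) 0; last by rewrite q0 ltxx.
by have := congr1 (fun c : 'cV[R]_m => c i 0) c0; rewrite !mxE.
Qed.

(** * The Lyapunov equation *)

Lemma lyapunov_inj {R : realType} {k : nat} (B U : 'M[R]_k) :
  sympos B -> B *m U + U *m B = 0 -> U = 0.
Proof.
move=> B_sp BU.
(* Multiply the equation by U^T and take the trace: by cyclicity this is a sum of two nonnegative
   terms, so both vanish. *)
have tr0 : \tr (U^T *m B *m U) + \tr (U^T^T *m B *m U^T) = 0.
  rewrite trmxK [X in _ + X]mxtrace_mulC -mulmxA -mxtraceD.
  by rewrite -mulmxDr BU mulmx0 mxtrace0.
apply: (sympos_trace_eq0 _ _ B_sp); apply/eqP.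
by move/eqP: tr0; rewrite paddr_eq0 ?sympos_trace_ge0// => /andP[].
Qed.

Lemma lyapunov_ex {R : realType} {k : nat} (B C : 'M[R]_k) :
  sympos B -> exists U, lyapunov_sol B C U.
Proof.
move=> B_sp.
(* The matrix of the Lyapunov operator acting on vectorized matrices; its kernel is trivial, so it
   is invertible. *)
pose L := lin_mulmx B + lin_mulmxr B.
have LE U : vec_mx (mxvec U *m L) = B *m U + U *m B.
  by rewrite mulmxDr raddfD /= !mul_vec_lin !mxvecK.
have L_unit : L \in unitmx.
  rewrite -row_free_unit -kermx_eq0; apply/rowV0P => u /sub_kermxP uL.
  have := LE (vec_mx u); rewrite vec_mxK uL linear0 => /esym /(lyapunov_inj _ _ B_sp).
  by move=> u0; rewrite -[u]vec_mxK u0 linear0.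
exists (vec_mx (mxvec C *m invmx L)).
by rewrite /lyapunov_sol -LE vec_mxK mulmxKV// mxvecK.
Qed.

(** Transposing the equation shows that U^T is also a solution, so injectivity applies to the
    difference. *)
Lemma lyapunov_sol_sym {R : realType} {k : nat} (B C U : 'M[R]_k) :
  sympos B -> C^T = C -> lyapunov_sol B C U -> U^T = U.
Proof.
move=> B_sp C_sym BU; have [B_sym _] := B_sp.
apply/eqP; rewrite -subr_eq0; apply/eqP; apply: (lyapunov_inj _ _ B_sp).
have UB : B *m U^T + U^T *m B = C.
  by rewrite -C_sym -BU [RHS]raddfD /= !trmx_mul B_sym addrC.
by rewrite mulmxBr mulmxBl addrACA -opprD UB BU subrr.
Qed.

(** * The trace pairing and the Riemannian gradient *)

Lemma mxtrace_sym_skew {R : realType} {k : nat} (U K : 'M[R]_k) :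
  U^T = U -> K^T = - K -> \tr (U *m K) = 0.
Proof.
move=> U_sym K_skew.
have : \tr (U *m K) = - \tr (U *m K).
  by rewrite -[LHS]mxtrace_tr trmx_mul U_sym K_skew mulNmx linearN/= mxtrace_mulC.
by lra.
Qed.

(** By linearity of the differential, after expanding [Z] in elementary matrices. *)
Lemma mxtrace_egrad {R : realType} {n k : nat} (g : 'M[R]_(n, k) -> R)
    (X Z : 'M[R]_(n, k)) :
  differentiable g X -> \tr ((egrad g X)^T *m Z) = 'd g X Z.
Proof.
move=> dg; rewrite [in RHS](matrix_sum_delta Z) [LHS]/mxtrace raddf_sum /=.
under [RHS]eq_bigr do rewrite raddf_sum /=.
rewrite [RHS]exchange_big /=; apply: eq_bigr => j _; rewrite mxE.
by apply: eq_bigr => i _; rewrite linearZ !mxE (deriveE _ dg) mulrC.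
Qed.

Theorem proposition3p3 (R : realType) (n k : nat)
    (k_ge1 : (1 <= k)%N) (k_le_n : (k <= n)%N)
    (A : 'M[R]_n) (A_sym : A^T = A) (A_unit : A \in unitmx)
    (J : 'M[R]_k) (J_sym : J^T = J) (J_invol : J *m J = 1%:M)
    (M : 'M[R]_(n, k) -> 'M[R]_n)
    (M_sympos : forall Y, iSt A J Y -> sympos (M Y))
    (M_smooth : C1_along (iSt A J) M)
    (f : 'M[R]_(n, k) -> R)
    (f_C1 : C1_along (iSt A J) f)
    (X : 'M[R]_(n, k)) (X_iSt : iSt A J X)
    (fbar : 'M[R]_(n, k) -> R)
    (fbar_ext : C1_extension (iSt A J) f X fbar) :
  exists U : 'M[R]_k,
    unique (lyapunov_sol (X^T *m A *m invmx (M X) *m A *m X)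
              (2 *: sym (X^T *m A *m invmx (M X) *m egrad fbar X))) U /\
    unique (is_riem_grad A J M f X)
      (invmx (M X) *m egrad fbar X - invmx (M X) *m A *m X *m U).
Proof.
have MX_sp := M_sympos _ X_iSt; have MX_u := sympos_unitmx _ MX_sp.
have MiX_sp := sympos_inv _ MX_sp; have [Mi_sym _] := MiX_sp.
have [M_sym _] := MX_sp.
set D := egrad fbar X; set N := M X; set Ni := invmx N.
set B := X^T *m A *m Ni *m A *m X; set C := 2 *: sym _.
have B_sp : sympos B.
  have -> : B = (A *m X)^T *m Ni *m (A *m X) by rewrite trmx_mul A_sym !mulmxA.
  apply: (@sympos_congr _ _ _ _ _ (J *m X^T)) => //.
  by rewrite -mulmxA (mulmxA X^T) X_iSt.
have CE : C = X^T *m A *m Ni *m D + (X^T *m A *m Ni *m D)^T.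
  by rewrite /C /sym scalerA divff ?scale1r// pnatr_eq0.
have C_sym : C^T = C by rewrite CE [LHS]raddfD /= trmxK addrC.
have [U BU] := lyapunov_ex _ C B_sp.
have U_sym := lyapunov_sol_sym _ _ _ B_sp C_sym BU.
set G := Ni *m D - Ni *m A *m X *m U.
have XAG : X^T *m A *m G = X^T *m A *m Ni *m D - B *m U.
  by rewrite mulmxBr /B !mulmxA.
(* By [XAG], the sum of X^T A G and its transpose is C - (B U + U B), which is 0. *)
have G_tan : tangent A X G.
  have GAX : G^T *m A *m X = (X^T *m A *m G)^T.
    by rewrite !trmx_mul trmxK A_sym mulmxA.
  rewrite /tangent /= GAX XAG [(_ - _)^T]raddfB /= [(B *m U)^T]trmx_mul.
  have [B_sym _] := B_sp.
  by rewrite B_sym U_sym addrACA -opprD [U *m B + _]addrC BU [X in X - _]addrC -CE subrr.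
have G_metric Z : tangent A X Z -> metric N G Z = \tr (D^T *m Z).
  move=> Z_tan.
  (* The factor N cancels its inverse, leaving the Euclidean pairing and a correction that pairs the
     symmetric U with the skew X^T A Z. *)
  have GN : G^T *m N = D^T - U *m (X^T *m A).
    rewrite -[LHS]trmxK trmx_mul trmxK M_sym mulmxBr !mulmxA mulmxV// !mul1mx.
    by rewrite [LHS]raddfB /= !trmx_mul U_sym A_sym mulmxA.
  rewrite /metric GN mulmxBl [LHS]raddfB /= -[U *m _ *m _]mulmxA.
  rewrite mxtrace_sym_skew ?subr0//.
  rewrite !trmx_mul trmxK A_sym mulmxA.
  by apply/eqP; rewrite -addr_eq0; apply/eqP.
have dfbar := C1_extension_differentiable fbar_ext.
have G_grad : is_riem_grad A J M f X G.
  split=> // g g_ext Z Z_tan.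
  have [c [c0 [dc cZ] cS]] := tangent_curve _ _ _ _ A_sym J_sym J_invol X_iSt Z_tan.
  rewrite G_metric// (mxtrace_egrad _ _ _ dfbar) -cZ -c0.
  by rewrite -c0 in fbar_ext g_ext; exact: C1_extension_diff_curve fbar_ext g_ext dc cS.
exists U; split; split => //.
  move=> V BV; apply/eqP; rewrite -subr_eq0; apply/eqP.
  apply: (lyapunov_inj _ _ B_sp).
  by rewrite mulmxBr mulmxBl addrACA -opprD BU BV subrr.
move=> H [H_tan H_grad].
(* Both gradients are tested on their own difference, itself tangent; its squared norm is then 0. *)
have GH_tan : tangent A X (G - H).
  rewrite /tangent /= [(_ - _)^T]raddfB /= !mulmxBl mulmxBr addrACA -opprD.
  by rewrite G_tan H_tan subrr.
apply/eqP; rewrite -subr_eq0; apply/eqP; apply: (sympos_trace_eq0 _ _ MX_sp).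
rewrite [(_ - _)^T]raddfB /= !mulmxBl [LHS]raddfB /=.
have [_ /(_ _ fbar_ext _ GH_tan) EG] := G_grad.
have EH := H_grad _ fbar_ext _ GH_tan.
by apply/eqP; rewrite subr_eq0; apply/eqP; rewrite [LHS]EG [RHS]EH.
Qed.
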